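(* Let $k,r$ be nonnegative integers, $y_1,\dots,y_k\in\mathbb R^r$, $d\in\mathbb R^k_+$, and $R:=[y_1,\dots,y_k]^\top\in\mathbb R^{k\times r}$. Let $$\mathcal B_{R,d}:=\{x\in\mathbb R^r:\ \|x-y_i\|^2=d_i^2\ \text{ for all } i\in[k]\}$$ and suppose $\mathcal B_{R,d}\ne\emptyset$. Then: (i) If $\mathrm{rank}([e,R])=k$ and there exists $x\in\mathcal B_{R,d}$ at which LICQ does not hold, then $\mathcal B_{R,d}=\{x\}$. (ii) If $\mathrm{rank}([e,R])\le k-1$, then there exists a proper subset $\mathcal I\subsetneq[k]$ such that $\mathcal B_{R,d}=\mathcal B_{R_{\mathcal I},d_{\mathcal I}}$. Moreover, $\mathcal B_{R,d}$ is a Riemannian submanifold of $\mathbb R^r$.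
   Context: $[k]=\{1,\dots,k\}$; $\mathbb R^k_+$ is the set of vectors with nonnegative entries; $e\in\mathbb R^k$ is the all-ones vector and $[e,R]\in\mathbb R^{k\times(r+1)}$ is the matrix obtained by prepending the column $e$ to $R$. For $\mathcal I\subset[k]$, $R_{\mathcal I}$ and $d_{\mathcal I}$ are the submatrix of rows and the subvector of entries indexed by $\mathcal I$, so $\mathcal B_{R_{\mathcal I},d_{\mathcal I}}=\{x\in\mathbb R^r:\|x-y_i\|^2=d_i^2\ \forall i\in\mathcal I\}$. LICQ (linear independence constraint qualification) holds at $x\in\mathcal B_{R,d}$ if the gradients of the constraint functions at $x$, equivalently the vectors $x-y_1,\dots,x-y_k$, are linearly independent. A Riemannian submanifold of $\mathbb R^r$ is an embedded smooth submanifold with the metric induced by $\mathbb R^r$; a single point counts as a (zero-dimensional) one. *)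

(* Defs.v *)
From mathcomp Require Import all_boot all_order all_algebra.
From mathcomp Require Import all_classical all_reals all_analysis.

Set Implicit Arguments.
Unset Strict Implicit.
Unset Printing Implicit Defensive.

Import Order.TTheory GRing.Theory Num.Theory.
Import numFieldNormedType.Exports.

Local Open Scope classical_set_scope.
Local Open Scope ring_scope.

(* The library norm [`|x|] on row vectors is the sup norm; it induces the usual
   topology of R^r but is not the Euclidean norm, hence this definition. *)
Definition enorm (F : realType) (r : nat) (x : 'rV[F]_r) : F :=
  Num.sqrt (\sum_(j < r) x 0 j ^+ 2).

(* The rows of [R] are the centers y_i. *)
Definition constraint (F : realType) (k r : nat) (R : 'M[F]_(k, r))
    (d : 'cV[F]_k) (i : 'I_k) (x : 'rV[F]_r) : F :=
  enorm (x - row i R) ^+ 2 - d i 0 ^+ 2.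

Definition ball_boundaries (F : realType) (k r : nat) (R : 'M[F]_(k, r))
    (d : 'cV[F]_k) : set 'rV[F]_r :=
  [set x | forall i : 'I_k, enorm (x - row i R) ^+ 2 = d i 0 ^+ 2].

Definition unit_row (F : realType) (r : nat) (j : 'I_r) : 'rV[F]_r :=
  delta_mx 0 j.

Definition gradient (F : realType) (r : nat) (f : 'rV[F]_r -> F)
    (x : 'rV[F]_r) : 'rV[F]_r :=
  \row_(j < r) 'D_(unit_row F j) f x.

Definition licq (F : realType) (k r : nat) (R : 'M[F]_(k, r)) (d : 'cV[F]_k)
    (x : 'rV[F]_r) : Prop :=
  row_free (\matrix_(i < k) gradient (constraint R d i) x).

(* [e, R], of shape k x (r + 1). *)
Definition prepend_ones (F : realType) (k r : nat) (R : 'M[F]_(k, r)) :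
    'M[F]_(k, 1 + r) :=
  row_mx (const_mx 1) R.

Definition rows_in (F : realType) (k p : nat) (I : {set 'I_k})
    (A : 'M[F]_(k, p)) : 'M[F]_(#|I|, p) :=
  rowsub (fun i : 'I_#|I| => enum_val i) A.

(* All iterated partial derivatives of order at most [n] exist and are
   continuous on [U], which is meant to be open. *)
Fixpoint Cn_on (F : realType) (r n : nat) (U : set 'rV[F]_r)
    (f : 'rV[F]_r -> F) : Prop :=
  (forall x, U x -> {for x, continuous f}) /\
  match n with
  | 0 => True
  | n'.+1 => forall j : 'I_r,
      (forall x, U x -> derivable f x (unit_row F j)) /\
      Cn_on n' U (fun x => 'D_(unit_row F j) f x)
  end.

Definition smooth_on (F : realType) (r s : nat) (U : set 'rV[F]_r)
    (f : 'rV[F]_r -> 'rV[F]_s) : Prop :=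
  forall (n : nat) (j : 'I_s), Cn_on n U (fun x => f x 0 j).

Definition diffeomorphism (F : realType) (r : nat) (U V : set 'rV[F]_r)
    (f g : 'rV[F]_r -> 'rV[F]_r) : Prop :=
  [/\ smooth_on U f, smooth_on V g,
      forall x, U x -> V (f x) /\ g (f x) = x &
      forall z, V z -> U (g z) /\ f (g z) = z].

(* R^m x {0} inside R^r. *)
Definition coordinate_slice (F : realType) (r m : nat) : set 'rV[F]_r :=
  [set z | forall j : 'I_r, (m <= j)%N -> z 0 j = 0].

(* The local slice condition: near each of its points, [S] is straightened to
   R^m x {0} by a diffeomorphism between open subsets of R^r. *)
Definition embedded_submanifold (F : realType) (r m : nat)
    (S : set 'rV[F]_r) : Prop :=
  (m <= r)%N /\
  forall x, S x ->
    exists (U V : set 'rV[F]_r) (f g : 'rV[F]_r -> 'rV[F]_r),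
      [/\ open U, open V, U x, diffeomorphism U V f g &
          f @` (S `&` U) = coordinate_slice m `&` V].

(* A Riemannian submanifold of R^r carries by definition the metric induced by
   R^r, i.e. the restriction of the Euclidean inner product to the tangent
   spaces; the set determines it, so it is not a further datum. *)
Definition riemannian_submanifold (F : realType) (r : nat)
    (S : set 'rV[F]_r) : Prop :=
  exists m : nat, embedded_submanifold m S.

(* Main.v *)
Require Import Defs.
From mathcomp Require Import all_boot all_order all_algebra.
From mathcomp Require Import all_classical all_reals all_analysis.
From mathcomp Require Import ring.

Set Implicit Arguments.
Unset Strict Implicit.
Unset Printing Implicit Defensive.

Import Order.TTheory GRing.Theory Num.Theory.
Import numFieldNormedType.Exports.

Local Open Scope classical_set_scope.
Local Open Scope ring_scope.

(** The statement rests on one identity.  Let [p] lie on all the spheres, put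
    [w = x - p], and subtract the equation of the [i]-th sphere at [p] from the
    same equation at [x]:
      [|x - y_i|^2 - d_i^2 = |w|^2 + 2 <w, p - y_i>].
    Hence [x] lies on all the spheres iff
      [|w|^2 e + 2 M_p w = 0], where [M_p] has the rows [p - y_i]
    ([constraints_from_point]).

    Multiply by a row [l] with [l M_p = 0]: if [x <> p] is also on all the
    spheres then [l e = 0], and then [l [e, R] = 0].  So, as soon as the
    intersection has two points, [M_p] and [[e, R]] have the same left kernel
    ([left_kernel_offsets]).  At a point [p] without LICQ, [M_p] has a nonzero
    left kernel; a second point would give one to [[e, R]], against
    [rank [e, R] = k], and this is (i).  For (ii), a nonzero [l] with
    [l [e, R] = 0] kills the identity at every [x], so a sphere whose
    coefficient in [l] is nonzero contains every common point of the others.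

    For the submanifold, a single point is straightened by a translation.
    Otherwise, near a point [x0], choose another point [p] of the
    intersection and apply the inversion [w |-> w / |w|^2] centred at [p].  All
    the spheres pass through [p], so they all become hyperplanes: with
    [v = w / |w|^2] the system reads [e + 2 M_p v = 0].  This is an affine
    subspace of dimension [r - rank M_p = r - rank [e, R]], which does not
    depend on [p], and a linear change of coordinates maps it to a coordinate
    slice.  The resulting chart and its inverse are rational, hence smooth,
    because partial derivatives of rational functions are again rational
    ([rational_Cn]). *)

(** * Rational functions are smooth *)

(** This class is closed under partial derivatives, so one derivative at a time
    gives all orders; it contains the components of every chart used below. *)
Inductive rational_on (F : realType) (r : nat) (U : set 'rV[F]_r) :
    ('rV[F]_r -> F) -> Prop :=
| rational_cst c : rational_on U (fun=> c)
| rational_coord j : rational_on U (fun x => x 0 j)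
| rational_add f g : rational_on U f -> rational_on U g ->
    rational_on U (fun x => f x + g x)
| rational_mul f g : rational_on U f -> rational_on U g ->
    rational_on U (fun x => f x * g x)
| rational_inv f : rational_on U f -> (forall x, U x -> f x != 0) ->
    rational_on U (fun x => (f x)^-1).

Section RationalFunctions.
Variables (F : realType) (r : nat).
Implicit Types (U : set 'rV[F]_r) (f g : 'rV[F]_r -> F).

Lemma rational_differentiable U f x :
  rational_on U f -> U x -> differentiable f x.
Proof.
move=> rf Ux; elim: rf => {f} [c|j|f g _ df _ dg|f g _ df _ dg|f _ df f0].
- exact: differentiable_cst.
- exact: differentiable_coord.
- exact: differentiableD.
- exact: differentiableM.
- by apply: differentiableV => //; apply: f0.
Qed.

Lemma derive_rational U f (j : 'I_r) : rational_on U f ->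
  exists2 g, rational_on U g &
    forall x, U x -> 'D_(unit_row F j) f x = g x.
Proof.
have der (h : 'rV[F]_r -> F) x : rational_on U h -> U x ->
    derivable h x (unit_row F j).
  by move=> rh Ux; apply: diff_derivable; apply: rational_differentiable rh Ux.
elim=> {f} [c|i|f g rf [f' rf' ff'] rg [g' rg' gg']
           |f g rf [f' rf' ff'] rg [g' rg' gg']|f rf [f' rf' ff'] f0].
- exists (fun=> 0); first exact: rational_cst.
  by move=> x _; rewrite derive_cst.
- exists (fun=> unit_row F j 0 i); first exact: rational_cst.
  move=> x Ux; rewrite /derive.
  apply: lim_near_cst => //; near=> h.
  rewrite /= !mxE addrK.
  rewrite /GRing.scale/= mulrA mulVf ?mul1r //.
  by near: h; exact: nbhs_dnbhs_neq.
- exists (fun x => f' x + g' x); first exact: rational_add.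
  by move=> x Ux; rewrite deriveD ?ff' ?gg'//; apply: der.
- exists (fun x => f x * g' x + g x * f' x).
    by apply: rational_add; apply: rational_mul.
  by move=> x Ux; rewrite deriveM ?ff' ?gg'//; apply: der.
- exists (fun x => (-1 * ((f x)^-1 * (f x)^-1)) * f' x).
    apply: rational_mul => //; apply: rational_mul; first exact: rational_cst.
    by apply: rational_mul; apply: rational_inv.
  move=> x Ux; rewrite deriveV ?ff'//; [|exact: f0|exact: der].
  by rewrite mulN1r -invfM -expr2.
Unshelve. all: by end_near. Qed.

(** The function [g] that agrees with [f] on [U] lets the induction go
    through: a partial derivative of a rational function equals a rational
    function on [U] only. *)
Lemma rational_Cn n U f g : open U -> rational_on U f ->
  (forall x, U x -> f x = g x) -> Cn_on n U g.
Proof.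
move=> oU; elim: n f g => [|n IHn] f g rf fg.
all: have fg_near x : U x -> \near x, f x = g x by
  move=> Ux; apply: filterS fg _; apply: open_nbhs_nbhs.
all: have cg x (Ux : U x) : {for x, continuous g} by
  rewrite /prop_for /continuous_at -(fg x Ux);
  have cf := differentiable_continuous (rational_differentiable rf Ux);
  exact: cvg_trans (near_eq_cvg (fg_near x Ux)) cf.
  by split.
split=> // j; split.
  move=> x Ux; apply: near_eq_derivable (fg_near x Ux) _.
  by apply: diff_derivable; apply: rational_differentiable rf Ux.
have [f' rf' ff'] := derive_rational j rf.
apply: (IHn f') => // x Ux.
by rewrite -ff'//; apply: near_eq_derive; apply: fg_near.
Qed.

Lemma rational_neq0_open f :
  rational_on setT f -> open [set x | f x != 0].
Proof.
move=> rf; apply: (open_comp (f := f) (D := [set y | y != 0])); last exact: open_neq.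
by move=> x _; apply/differentiable_continuous/(rational_differentiable rf).
Qed.

Lemma rational_sum U (I : Type) (s : seq I) (f : I -> 'rV[F]_r -> F) :
  (forall i, rational_on U (f i)) -> rational_on U (fun x => \sum_(i <- s) f i x).
Proof.
move=> rf; elim: s => [|i s IHs].
  by under eq_fun do rewrite big_nil; apply: rational_cst.
by under eq_fun do rewrite big_cons; apply: rational_add.
Qed.

Definition rational_map_on U s (f : 'rV[F]_r -> 'rV[F]_s) :=
  forall j, rational_on U (fun x => f x 0 j).

Lemma rational_smooth U s (f : 'rV[F]_r -> 'rV[F]_s) :
  open U -> rational_map_on U f -> smooth_on U f.
Proof. by move=> oU rf n j; apply: rational_Cn (rf j) _. Qed.

Lemma rational_map_id U : rational_map_on U id.
Proof. by move=> j; apply: rational_coord. Qed.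

Lemma rational_map_addr U s (f : 'rV[F]_r -> 'rV[F]_s) c :
  rational_map_on U f -> rational_map_on U (fun x => f x + c).
Proof.
move=> rf j; under eq_fun do rewrite mxE.
by apply: rational_add (rf j) _; apply: rational_cst.
Qed.

Lemma rational_map_mulmx U s t (f : 'rV[F]_r -> 'rV[F]_s) (A : 'M[F]_(s, t)) :
  rational_map_on U f -> rational_map_on U (fun x => f x *m A).
Proof.
move=> rf j; under eq_fun do rewrite mxE.
apply: rational_sum => i; apply: rational_mul (rf i) _.
exact: rational_cst.
Qed.

End RationalFunctions.

(** * Inversion in the unit sphere *)

Section Inversion.
Variables (F : realType) (r : nat).
Implicit Types u v w : 'rV[F]_r.

Definition dot u v : F := (u *m v^T) 0 0.

Lemma dotE u v : dot u v = \sum_j u 0 j * v 0 j.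
Proof. by rewrite /dot mxE; apply: eq_bigr => j _; rewrite mxE. Qed.

Lemma dotC u v : dot u v = dot v u.
Proof. by rewrite !dotE; apply: eq_bigr => j _; rewrite mulrC. Qed.

Lemma dotDl u v w : dot (u + v) w = dot u w + dot v w.
Proof. by rewrite /dot mulmxDl mxE. Qed.

Lemma dotZl c u v : dot (c *: u) v = c * dot u v.
Proof. by rewrite /dot -scalemxAl mxE. Qed.

Lemma dot_sqrD u v : dot (u + v) (u + v) = dot u u + 2 * dot u v + dot v v.
Proof.
by rewrite !(dotDl, dotC _ (u + v)) (dotC v u) mulr_natl mulr2n !addrA.
Qed.

Lemma dot_eq0 u : (dot u u == 0) = (u == 0).
Proof.
apply/eqP/eqP => [|->]; last by rewrite /dot mul0mx mxE.
rewrite dotE => /eqP; rewrite psumr_eq0 => [/allP u0|j _]; last first.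
  by rewrite -expr2 sqr_ge0.
apply/rowP => j; rewrite mxE; apply/eqP.
by have := u0 j (mem_index_enum _); rewrite mulf_eq0 orbb.
Qed.

Lemma enorm_sqr u : enorm u ^+ 2 = dot u u.
Proof.
rewrite /enorm sqr_sqrtr; first by rewrite dotE; apply: eq_bigr.
by apply: sumr_ge0 => j _; rewrite sqr_ge0.
Qed.

Definition inversion u : 'rV[F]_r := (dot u u)^-1 *: u.

Lemma dot_inversion u : dot (inversion u) (inversion u) = (dot u u)^-1.
Proof.
rewrite /inversion dotZl dotC dotZl.
have [->|u0] := eqVneq (dot u u) 0; first by rewrite invr0 !mul0r.
by rewrite mulVf ?mulr1.
Qed.

Lemma inversionK : involutive inversion.
Proof.
move=> u; rewrite {1}/inversion dot_inversion invrK /inversion scalerA.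
have [/eqP|u0] := eqVneq (dot u u) 0; last by rewrite mulfV ?scale1r.
by rewrite dot_eq0 => /eqP ->; rewrite scaler0.
Qed.

Lemma rational_dot s (U : set 'rV[F]_s) (f : 'rV[F]_s -> 'rV[F]_r) :
  rational_map_on U f -> rational_on U (fun x => dot (f x) (f x)).
Proof.
move=> rf; under eq_fun do rewrite dotE.
by apply: rational_sum => j; apply: rational_mul.
Qed.

Lemma rational_map_inversion s (U : set 'rV[F]_s) (f : 'rV[F]_s -> 'rV[F]_r) :
  rational_map_on U f -> (forall x, U x -> dot (f x) (f x) != 0) ->
  rational_map_on U (fun x => inversion (f x)).
Proof.
move=> rf f0 j; under eq_fun do rewrite mxE.
by apply: rational_mul => //; apply: rational_inv => //; apply: rational_dot.
Qed.

End Inversion.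

(** * The system of spheres seen from one of its solutions *)

Section Spheres.
Variables (F : realType) (k r : nat) (R : 'M[F]_(k, r)) (d : 'cV[F]_k).
Implicit Types p x : 'rV[F]_r.

(** The matrix [M_p] with rows [p - y_i]. *)
Definition offsets p : 'M[F]_(k, r) := const_mx 1 *m p - R.

Lemma row_offsets p i : row i (offsets p) = p - row i R.
Proof.
by apply/rowP => j; rewrite !mxE big_ord1 !mxE mul1r.
Qed.

Lemma ball_boundariesP x :
  ball_boundaries R d x <-> forall i, constraint R d i x = 0.
Proof.
split=> Bx i; first by rewrite /constraint Bx subrr.
by apply/eqP; rewrite -subr_eq0; apply/eqP; apply: Bx.
Qed.

Lemma constraints_from_point p x : ball_boundaries R d p ->
  \col_i constraint R d i x =
  dot (x - p) (x - p) *: const_mx 1 + 2 *: (offsets p *m (x - p)^T).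
Proof.
move=> Bp; apply/colP => i.
have -> : (offsets p *m (x - p)^T) = \col_i dot (x - p) (p - row i R).
  apply/colP => l; rewrite [RHS]mxE dotC /dot -row_offsets -row_mul.
  by rewrite [RHS]mxE.
rewrite !mxE mulr1 /constraint enorm_sqr -Bp enorm_sqr.
have -> : x - row i R = (x - p) + (p - row i R) by rewrite addrA subrK.
by rewrite dot_sqrD addrK.
Qed.

Lemma ball_boundaries_from_point p x : ball_boundaries R d p ->
  ball_boundaries R d x <->
  dot (x - p) (x - p) *: const_mx 1 + 2 *: (offsets p *m (x - p)^T)
    = 0 :> 'cV[F]_k.
Proof.
move=> Bp; rewrite -constraints_from_point //; split=> [/ball_boundariesP|] Bx.
  by apply/colP => i; rewrite !mxE Bx.
by apply/ball_boundariesP => i; have /colP/(_ i) := Bx; rewrite !mxE.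
Qed.

Lemma mul_prepend_ones_eq0 m (l : 'M[F]_(m, k)) :
  l *m prepend_ones R = 0 <-> l *m (const_mx 1 : 'cV[F]_k) = 0 /\ l *m R = 0.
Proof.
rewrite /prepend_ones mul_mx_row; split=> [|[-> ->]]; last exact: row_mx0.
by rewrite -row_mx0 => /eq_row_mx.
Qed.

Lemma mul_offsets_eq0 m (l : 'M[F]_(m, k)) p :
  l *m prepend_ones R = 0 -> l *m offsets p = 0.
Proof.
by case/mul_prepend_ones_eq0 => l1 lR; rewrite mulmxBr mulmxA l1 lR mul0mx subr0.
Qed.

(** The converse inclusion of left kernels fails only when [p] is in the affine
    hull of the centers, and then [p] is the only common point of the
    spheres. *)
Lemma left_kernel_offsets m (l : 'M[F]_(m, k)) p x :
  ball_boundaries R d p -> ball_boundaries R d x -> x != p ->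
  l *m offsets p = 0 -> l *m prepend_ones R = 0.
Proof.
move=> Bp Bx xp lM; apply/mul_prepend_ones_eq0.
have l1 : l *m (const_mx 1 : 'cV[F]_k) = 0.
  have /(congr1 (mulmx l)) := (ball_boundaries_from_point x Bp).1 Bx.
  rewrite mulmxDr -!scalemxAr mulmxA lM mul0mx scaler0 addr0 mulmx0.
  by move/eqP; rewrite scaler_eq0 dot_eq0 subr_eq0 (negPf xp) => /eqP.
split=> //; move: lM; rewrite mulmxBr mulmxA l1 mul0mx sub0r => /eqP.
by rewrite oppr_eq0 => /eqP.
Qed.

Lemma rank_offsets p x :
  ball_boundaries R d p -> ball_boundaries R d x -> x != p ->
  \rank (offsets p) = \rank (prepend_ones R).
Proof.
move=> Bp Bx xp.
have eq_ker : (kermx (offsets p) == kermx (prepend_ones R))%MS.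
  apply/andP; split; apply/sub_kermxP.
    by apply: left_kernel_offsets Bp Bx xp _; apply: mulmx_ker.
  by apply: mul_offsets_eq0; apply: mulmx_ker.
have := eqmx_rank eq_ker; rewrite !mxrank_ker => eq_rank.
by rewrite -(subKn (rank_leq_row (offsets p))) eq_rank subKn ?rank_leq_row.
Qed.

Lemma dot_unit_row j (u : 'rV[F]_r) : dot (unit_row F j) u = u 0 j.
Proof. by rewrite /dot -rowE !mxE. Qed.

Lemma gradient_constraint i x :
  gradient (constraint R d i) x = 2 *: (x - row i R).
Proof.
apply/rowP => j; rewrite [LHS]mxE.
set u := x - row i R; rewrite /derive; apply: cvg_lim => //.
have quot : \forall h \near 0^', 2 * u 0 j + h =
    h^-1 *: ((constraint R d i \o shift x) (h *: unit_row F j)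
             - constraint R d i x).
  near=> h; rewrite /= /constraint !enorm_sqr -/u.
  have -> : h *: unit_row F j + x - row i R = h *: unit_row F j + u.
    by rewrite addrA.
  rewrite dot_sqrD !(dotZl, dotC _ (h *: _)) !dot_unit_row !mxE !eqxx.
  have h0 : h != 0 by near: h; exact: nbhs_dnbhs_neq.
  by rewrite /GRing.scale /=; field.
apply: cvg_trans (near_eq_cvg quot) _.
have -> : (2 *: u) 0 j = 2 * u 0 j + 0 by rewrite mxE addr0.
apply: cvgD; first exact: cvg_cst.
exact: nbhs_dnbhs.
Unshelve. all: by end_near. Qed.

Lemma licq_offsets x : licq R d x <-> row_free (offsets x).
Proof.
rewrite /licq; have -> : \matrix_i gradient (constraint R d i) x = 2 *: offsets x.
  by apply/row_matrixP => i; rewrite rowK gradient_constraint linearZ /= row_offsets.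
by rewrite /row_free mxrank_scale_nz // pnatr_eq0.
Qed.

Lemma not_licq_singleton x :
  \rank (prepend_ones R) = k -> ball_boundaries R d x -> ~ licq R d x ->
  ball_boundaries R d = [set x].
Proof.
move=> rkR Bx nlicq; apply/seteqP; split=> [x' Bx' /=|_ -> //].
apply/eqP/negPn/negP => x'x; apply: nlicq; apply/licq_offsets.
by rewrite /row_free (rank_offsets Bx Bx' x'x) rkR.
Qed.

(** A row [l] with [l [e, R] = 0] gives a linear relation between the constraints
    at every point, because they all vanish at [p]; it expresses one of them
    through the others. *)
Lemma redundant_sphere p : ball_boundaries R d p ->
  (\rank (prepend_ones R) < k)%N ->
  exists I : {set 'I_k}, I \proper [set: 'I_k]%SET /\
    ball_boundaries R d = ball_boundaries (rows_in I R) (rows_in I d).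
Proof.
move=> Bp rkR.
have : kermx (prepend_ones R) != 0 by rewrite -mxrank_eq0 mxrank_ker subn_eq0 -ltnNge.
case/rowV0Pn=> l /sub_kermxP lR /rV0Pn[i0 li0].
have rowI (I : {set 'I_k}) i : row i (rows_in I R) = row (enum_val i) R.
  by apply/rowP => j; rewrite !mxE.
exists [set~ i0]%SET; split.
  by rewrite properT; apply/eqP => /setP/(_ i0); rewrite !inE eqxx.
apply/seteqP; split=> x /= Bx.
  by move=> i; rewrite rowI mxE; apply: Bx.
have others i : i != i0 -> constraint R d i x = 0.
  move=> ii0; have iI : i \in [set~ i0]%SET by rewrite !inE.
  have := Bx (enum_rank_in iI i); rewrite rowI mxE enum_rankK_in //.
  by rewrite /constraint => ->; rewrite subrr.
suff ci0 : constraint R d i0 x = 0.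
  apply/ball_boundariesP => i; have [->//|] := eqVneq i i0; exact: others.
have /(congr1 (mulmx l)) := constraints_from_point x Bp.
have [l1 _] := (mul_prepend_ones_eq0 l).1 lR.
rewrite mulmxDr -!scalemxAr mulmxA l1 (mul_offsets_eq0 p lR) mul0mx !scaler0 addr0.
move/rowP/(_ 0); rewrite !mxE (bigD1 i0) //= big1 => [|i ii0]; last first.
  by rewrite mxE others // mulr0.
by rewrite addr0 mxE => /eqP; rewrite mulf_eq0 (negPf li0) => /eqP.
Qed.

End Spheres.

(** * Charts of points and of intersections of spheres *)

Section Charts.
Variables (F : realType) (r : nat).
Implicit Types (U V S : set 'rV[F]_r).

Lemma diffeomorphism_image U V S m f g : diffeomorphism U V f g ->
  (forall x, U x -> S x <-> coordinate_slice m (f x)) ->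
  f @` (S `&` U) = coordinate_slice m `&` V.
Proof.
case=> _ _ fK gK Sf; apply/seteqP; split=> [_ [x [Sx Ux] <-]|z [mz Vz]].
  by split; [apply/(Sf x Ux)|have [] := fK x Ux].
have [Ug gz] := gK z Vz; exists (g z) => //; split=> //.
by apply/(Sf _ Ug); rewrite gz.
Qed.

Lemma embedded_point x0 : embedded_submanifold 0 [set x0 : 'rV[F]_r].
Proof.
split=> // _ ->.
have chart : diffeomorphism setT setT (fun x => x - x0) (fun z => z + x0).
  split.
  - apply: rational_smooth; first exact: openT.
    by apply/rational_map_addr/rational_map_id.
  - apply: rational_smooth; first exact: openT.
    by apply/rational_map_addr/rational_map_id.
  - by move=> x _; rewrite subrK.
  - by move=> z _; rewrite addrK.
exists setT, setT, (fun x => x - x0), (fun z => z + x0); split=> //.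
- exact: openT.
- exact: openT.
apply: diffeomorphism_image chart _ => x _; split=> [->|x0x].
  by move=> j _; rewrite subrr mxE.
by apply/eqP; rewrite -subr_eq0; apply/eqP/rowP => j; rewrite x0x // mxE.
Qed.

(** The first [\rank K] rows of [row_ebase K] form a basis of the row space of
    [K], and its other rows complete it to a basis of the whole space. *)
Lemma submx_coordinates (K : 'M[F]_r) (u : 'rV[F]_r) :
  (u <= K)%MS <-> coordinate_slice (\rank K) (u *m invmx (row_ebase K)).
Proof.
have -> : (u <= K)%MS = (u *m invmx (row_ebase K) *m copid_mx (\rank K) == 0).
  by rewrite submxE -mulmxA.
move: (u *m _) => w.
have coord j : (w *m copid_mx (\rank K)) 0 j = if (j < \rank K)%N then 0 else w 0 j.
  rewrite mulmxBr mulmx1 !mxE (bigD1 j) //= big1 => [|i ij].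
    by rewrite addr0 !mxE eqxx /=; case: ifP; rewrite ?mulr1 ?mulr0 ?subrr ?subr0.
  by rewrite mxE val_eqE (negPf ij) mulr0.
split=> [/eqP w0 j|w0].
  by rewrite leqNgt => jK; have := coord j; rewrite w0 mxE (negPf jK).
by apply/eqP/rowP => j; rewrite coord mxE; case: ltnP => // /w0.
Qed.

End Charts.

Section InversionChart.
Variables (F : realType) (r : nat) (p v0 : 'rV[F]_r) (Q : 'M[F]_r).

(** Inversion at [p], followed by the affine map that sends [v0] to the origin
    and has linear part [Q]. *)
Definition inversion_chart x := (inversion (x - p) - v0) *m Q.
Definition inversion_chart_inv z := inversion (z *m invmx Q + v0) + p.

Definition chart_domain := [set x : 'rV[F]_r | dot (x - p) (x - p) != 0 :> F].
Definition chart_codomain : set 'rV[F]_r :=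
  [set z | dot (z *m invmx Q + v0) (z *m invmx Q + v0) != 0 :> F].

Lemma open_chart_domain : open chart_domain.
Proof.
by apply/rational_neq0_open/rational_dot/rational_map_addr/rational_map_id.
Qed.

Lemma open_chart_codomain : open chart_codomain.
Proof.
apply/rational_neq0_open/rational_dot/rational_map_addr.
by apply/rational_map_mulmx/rational_map_id.
Qed.

Lemma inversion_chart_diffeomorphism : Q \in unitmx ->
  diffeomorphism chart_domain chart_codomain inversion_chart inversion_chart_inv.
Proof.
move=> unitQ; split.
- apply: rational_smooth open_chart_domain _.
  apply/rational_map_mulmx/rational_map_addr/rational_map_inversion => //.
  by apply/rational_map_addr/rational_map_id.
- apply: rational_smooth open_chart_codomain _.
  apply/rational_map_addr/rational_map_inversion => //.
  by apply/rational_map_addr/rational_map_mulmx/rational_map_id.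
- move=> x Ux; rewrite /chart_codomain /inversion_chart_inv /inversion_chart /=.
  by rewrite mulmxK // subrK inversionK subrK dot_inversion invr_neq0.
- move=> z Vz; rewrite /chart_domain /inversion_chart_inv /inversion_chart /=.
  by rewrite addrK inversionK addrK mulmxKV // dot_inversion invr_neq0.
Qed.

End InversionChart.

(** Dividing the quadratic system of [ball_boundaries_from_point] by [|x - p|^2]
    makes it affine in the inverted point: spheres through [p] become
    hyperplanes. *)
Lemma ball_boundaries_inversion (F : realType) (k r : nat) (R : 'M[F]_(k, r))
    (d : 'cV[F]_k) (p x : 'rV[F]_r) : ball_boundaries R d p -> x != p ->
  ball_boundaries R d x <->
  2 *: (inversion (x - p) *m (offsets R p)^T) = - const_mx 1.
Proof.
move=> Bp xp; set w := x - p.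
have w0 : dot w w != 0 by rewrite dot_eq0 subr_eq0.
rewrite (ball_boundaries_from_point x Bp) -/w.
have -> : 2 *: (inversion w *m (offsets R p)^T) =
    (dot w w)^-1 *: (2 *: (offsets R p *m w^T))^T.
  by rewrite linearZ /= trmx_mul trmxK -scalemxAl !scalerA mulrC.
have -> : - const_mx 1 = (dot w w)^-1 *: (dot w w *: - const_mx 1) :> 'rV[F]_k.
  by rewrite scalerA mulVf // scale1r.
split=> [/eqP|/(scalerI (invr_neq0 w0))/(congr1 trmx)].
  rewrite addrC addr_eq0 => /eqP ->; congr (_ *: _).
  by rewrite linearN linearZ /= trmx_const scalerN.
rewrite trmxK => ->; rewrite linearZ linearN /= trmx_const.
by rewrite scalerN subrr.
Qed.

Lemma embedded_ball_boundaries (F : realType) (k r : nat) (R : 'M[F]_(k, r))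
    (d : 'cV[F]_k) :
  (forall x, ball_boundaries R d x -> exists2 p, ball_boundaries R d p & x != p) ->
  embedded_submanifold (r - \rank (prepend_ones R)) (ball_boundaries R d).
Proof.
move=> two_points; split=> [|x0 Bx0]; first exact: leq_subr.
have [p Bp x0p] := two_points x0 Bx0.
(* [K] spans the direction of the affine subspace onto which the inversion at
   [p] maps the intersection, and [v0] below is a point of that subspace. *)
set K := kermx (offsets R p)^T.
have rankK : \rank K = (r - \rank (prepend_ones R))%N.
  by rewrite mxrank_ker mxrank_tr (rank_offsets Bp Bx0 x0p).
set v0 := inversion (x0 - p).
have unitQ : invmx (row_ebase K) \in unitmx by rewrite unitmx_inv row_ebase_unit.
have chart := inversion_chart_diffeomorphism p v0 unitQ.
exists (chart_domain p), (chart_codomain v0 (invmx (row_ebase K))).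
exists (inversion_chart p v0 (invmx (row_ebase K))).
exists (inversion_chart_inv p v0 (invmx (row_ebase K))).
split=> //.
- exact: open_chart_domain.
- exact: open_chart_codomain.
- by rewrite /chart_domain /= dot_eq0 subr_eq0.
rewrite -rankK; apply: diffeomorphism_image chart _ => x Ux.
have xp : x != p by rewrite -subr_eq0 -dot_eq0.
have /(ball_boundaries_inversion Bp x0p) Bv0 := Bx0.
rewrite (ball_boundaries_inversion Bp xp) -Bv0 -submx_coordinates.
have two0 : 2 != 0 :> F by rewrite pnatr_eq0.
split=> [/(scalerI two0) eq_v|/sub_kermxP].
  by apply/sub_kermxP; rewrite mulmxBl eq_v subrr.
by rewrite mulmxBl => /eqP; rewrite subr_eq0 => /eqP ->.
Qed.

Theorem proposition3p1 (F : realType) (k r : nat) (R : 'M[F]_(k, r))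
    (d : 'cV[F]_k) (d_ge0 : forall i : 'I_k, 0 <= d i 0)
    (B_nonempty : ball_boundaries R d !=set0) :
  [/\ \rank (prepend_ones R) = k ->
        forall x : 'rV[F]_r, ball_boundaries R d x -> ~ licq R d x ->
          ball_boundaries R d = [set x],
      (\rank (prepend_ones R) < k)%N ->
        exists I : {set 'I_k}, I \proper [set: 'I_k]%SET /\
          ball_boundaries R d = ball_boundaries (rows_in I R) (rows_in I d) &
      riemannian_submanifold (ball_boundaries R d)].
Proof.
case: B_nonempty => p Bp; split.
- by move=> rkR x; apply: not_licq_singleton.
- exact: redundant_sphere Bp.
have [[x0 Bx0]|noB] := pselect (exists x0, ball_boundaries R d = [set x0]).
  by exists 0%N; rewrite Bx0; apply: embedded_point.
exists (r - \rank (prepend_ones R))%N; apply: embedded_ball_boundaries => x Bx.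
apply: contrapT => only_x; apply: noB; exists x.
apply/seteqP; split=> [y By /=|_ -> //].
apply/eqP/negPn/negP => yx; apply: only_x; exists y => //.
by rewrite eq_sym.
Qed.
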